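(* Let $\Omega$ be a set with two binary operations $\rightarrow$ and $\triangleright$. Consider the maps $\phi,\tau:\Omega^2\longrightarrow\Omega^2$ defined by $\phi(\alpha,\beta)=(\alpha\rightarrow\beta,\alpha\triangleright\beta)$ and $\tau(\alpha,\beta)=(\beta,\alpha)$. Then: 1. $(\Omega,\rightarrow,\triangleright)$ is an EAS if, and only if, $$(\mathrm{Id}\times\phi)\circ(\phi\times\mathrm{Id})\circ(\mathrm{Id}\times\phi)=(\phi\times\mathrm{Id})\circ(\mathrm{Id}\times\tau)\circ(\phi\times\mathrm{Id}).$$ 2. $(\Omega,\rightarrow,\triangleright)$ is a CEDS if, and only if, \begin{align*} (\mathrm{Id}\times\phi)\circ(\phi\times\mathrm{Id})\circ(\mathrm{Id}\times\phi)&=(\phi\times\mathrm{Id})\circ(\mathrm{Id}\times\tau)\circ(\phi\times\mathrm{Id}),\\ (\mathrm{Id}\times\phi)\circ(\mathrm{Id}\times\tau)\circ(\tau\times\mathrm{Id})\circ(\phi\times\mathrm{Id})&=(\tau\times\mathrm{Id})\circ(\phi\times\mathrm{Id})\circ(\mathrm{Id}\times\phi)\circ(\mathrm{Id}\times\tau). \end{align*}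
   Context: An extended associative semigroup (EAS) is a triple $(\Omega,\rightarrow,\triangleright)$, with $\Omega$ a set and $\rightarrow,\triangleright:\Omega^2\to\Omega$ maps such that for all $\alpha,\beta,\gamma\in\Omega$: $\alpha\rightarrow(\beta\rightarrow\gamma)=(\alpha\rightarrow\beta)\rightarrow\gamma$; $(\alpha\triangleright(\beta\rightarrow\gamma))\rightarrow(\beta\triangleright\gamma)=(\alpha\rightarrow\beta)\triangleright\gamma$; $(\alpha\triangleright(\beta\rightarrow\gamma))\triangleright(\beta\triangleright\gamma)=\alpha\triangleright\beta$. A commutative extended diassociative semigroup (CEDS) is such a triple satisfying, for all $\alpha,\beta,\gamma\in\Omega$: $\alpha\rightarrow(\beta\rightarrow\gamma)=(\alpha\rightarrow\beta)\rightarrow\gamma=(\beta\rightarrow\alpha)\rightarrow\gamma$; $\alpha\triangleright(\beta\rightarrow\gamma)=\alpha\triangleright\gamma$; $(\alpha\triangleright\gamma)\rightarrow(\beta\triangleright\gamma)=(\alpha\rightarrow\beta)\triangleright\gamma$; $(\alpha\triangleright\gamma)\triangleright(\beta\triangleright\gamma)=\alpha\triangleright\beta$. *)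

(* Defs.v *)
From mathcomp Require Import all_boot.

Set Implicit Arguments.
Unset Strict Implicit.
Unset Printing Implicit Defensive.

Section ExtendedSemigroups.

Variables (Omega : Type) (arr tri : Omega -> Omega -> Omega).

Local Notation "a → b" := (arr a b) (at level 40, no associativity).
Local Notation "a ▷ b" := (tri a b) (at level 40, no associativity).

Record is_EAS : Prop := IsEAS {
  eas_arrA : forall a b c, a → (b → c) = (a → b) → c;
  eas_arr_tri : forall a b c, (a ▷ (b → c)) → (b ▷ c) = (a → b) ▷ c;
  eas_tri_tri : forall a b c, (a ▷ (b → c)) ▷ (b ▷ c) = a ▷ b
}.

Record is_CEDS : Prop := IsCEDS {
  ceds_arrA : forall a b c, a → (b → c) = (a → b) → c;
  ceds_arr_perm : forall a b c, (a → b) → c = (b → a) → c;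
  ceds_tri_arr : forall a b c, a ▷ (b → c) = a ▷ c;
  ceds_arr_tri : forall a b c, (a ▷ c) → (b ▷ c) = (a → b) ▷ c;
  ceds_tri_tri : forall a b c, (a ▷ c) ▷ (b ▷ c) = a ▷ b
}.

Definition phi (p : Omega * Omega) : Omega * Omega :=
  (p.1 → p.2, p.1 ▷ p.2).

Definition tau : Omega * Omega -> Omega * Omega := @swap_pair Omega Omega.

End ExtendedSemigroups.

Arguments tau {Omega}.

(* Omega^3 is Omega * Omega * Omega, so that the identifications
   Omega * Omega^2 = Omega^3 = Omega^2 * Omega are built into these two maps. *)

Definition id_x (Omega : Type) (f : Omega * Omega -> Omega * Omega)
    (t : Omega * Omega * Omega) : Omega * Omega * Omega :=
  let: (a, b, c) := t in let: (b', c') := f (b, c) in (a, b', c').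

Definition x_id (Omega : Type) (f : Omega * Omega -> Omega * Omega)
    (t : Omega * Omega * Omega) : Omega * Omega * Omega :=
  let: (a, b, c) := t in let: (a', b') := f (a, b) in (a', b', c).

(* Main.v *)
Require Import Defs.
From mathcomp Require Import all_boot.

(** Each equation of maps is evaluated at a triple and read off by components. The three components
    of the first are exactly the three EAS axioms ([eas_braidP]). Those of the second amount to
    left-commutativity a → (b → c) = b → (a → c) and a ▷ (b → c) = a ▷ c ([swap_relationP]). A CEDS
    is an EAS with these two laws ([ceds_easP]). *)

Lemma eas_braidP (Omega : Type) (arr tri : Omega -> Omega -> Omega) :
  let ph := phi arr tri in
  is_EAS arr tri <->
    id_x ph \o x_id ph \o id_x ph =1 x_id ph \o id_x tau \o x_id ph.
Proof.
split=> [[arrA arr_tri tri_tri] [[a b] c] | braid].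
  by rewrite /= arrA arr_tri tri_tri.
by split=> a b c; case: (braid (a, b, c)).
Qed.

(** At (a, b, c) the two sides are (a ▷ b, c → (a → b), c ▷ (a → b)) and (a ▷ (c → b), a → (c → b),
    c ▷ b); the outer components express the same law. *)
Lemma swap_relationP (Omega : Type) (arr tri : Omega -> Omega -> Omega) :
  let ph := phi arr tri in
  (forall a b c, arr a (arr b c) = arr b (arr a c)) /\
  (forall a b c, tri a (arr b c) = tri a c) <->
    id_x ph \o id_x tau \o x_id tau \o x_id ph
      =1 x_id tau \o x_id ph \o id_x ph \o id_x tau.
Proof.
split=> [[arrCA tri_arr] [[a b] c] | swap].
  by rewrite /= !tri_arr arrCA.
(* The middle component at (b, c, a) gives the first law, the first component at (a, c, b) the
   second. *)
by split=> a b c; [case: (swap (b, c, a)) | case: (swap (a, c, b))].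
Qed.

(** Modulo a ▷ (b → c) = a ▷ c, the last two axioms of both structures coincide; modulo
    associativity, left-commutativity is [ceds_arr_perm]. *)
Lemma ceds_easP (Omega : Type) (arr tri : Omega -> Omega -> Omega) :
  is_CEDS arr tri <->
    is_EAS arr tri /\
    ((forall a b c, arr a (arr b c) = arr b (arr a c)) /\
     (forall a b c, tri a (arr b c) = tri a c)).
Proof.
split=> [[arrA arrAC tri_arr arr_tri tri_tri]
        | [[arrA arr_tri tri_tri] [arrCA tri_arr]]].
  split; first by split=> // a b c; rewrite tri_arr.
  by split=> // a b c; rewrite !arrA arrAC.
split=> // a b c; first by rewrite -!arrA arrCA.
  by rewrite -arr_tri tri_arr.
by rewrite -[RHS](tri_tri a b c) tri_arr.
Qed.

Theorem lemma1p4 (Omega : Type) (arr tri : Omega -> Omega -> Omega) :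
  let ph := phi arr tri in
  (is_EAS arr tri <->
     id_x ph \o x_id ph \o id_x ph =1 x_id ph \o id_x tau \o x_id ph)
  /\
  (is_CEDS arr tri <->
     (id_x ph \o x_id ph \o id_x ph =1 x_id ph \o id_x tau \o x_id ph)
     /\
     (id_x ph \o id_x tau \o x_id tau \o x_id ph
        =1 x_id tau \o x_id ph \o id_x ph \o id_x tau)).
Proof.
move=> ph; split; first exact: eas_braidP.
apply: iff_trans (ceds_easP _ _ _) _.
by split=> -[/eas_braidP ? /swap_relationP ?].
Qed.
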